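(* Let $n\ge1$. For $\mathbf{a}=(a_{1/2},a_{3/2})$, $$\prod_{i=1}^n\left(a_{1/2}(x_i^{1/2}+x_i^{-1/2})+a_{3/2}(x_i^{3/2}+x_i^{-3/2})\right)=\sum_{q=0}^n a_{3/2}^q\,\phi_r(\mathbf{a})\,\mathrm{ch}^{O(2n)}_{((3/2)^q,(1/2)^r)}(\mathbf{x},\overline{\mathbf{x}}),\qquad r=n-q,$$ where $$\phi_0(\mathbf{a})=1,\quad\phi_1(\mathbf{a})=a_{1/2},\quad\phi_2(\mathbf{a})=a_{1/2}^2-a_{1/2}a_{3/2}-a_{3/2}^2,$$ $$\phi_r(\mathbf{a})=a_{1/2}\,\phi_{r-1}(\mathbf{a})-a_{1/2}a_{3/2}\,\phi_{r-2}(\mathbf{a})+a_{3/2}^3\,\phi_{r-3}(\mathbf{a})\quad\text{if } r\ge3 .$$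
   Context: $\mathbf{x}=(x_1,\dots,x_n)$ are indeterminates (with formal square roots $x_i^{1/2}$), $\overline{\mathbf{x}}=(x_1^{-1},\dots,x_n^{-1})$; $a_{1/2},a_{3/2}$ are arbitrary scalar parameters. $((3/2)^q,(1/2)^r)$ is the weight whose first $q$ components are $3/2$ and last $r$ components are $1/2$. For a weight $\lambda$ with weakly decreasing positive half-odd-integer components, $\mathrm{ch}^{O(2n)}_\lambda(\mathbf{x},\overline{\mathbf{x}})$ is the spin character of $O(2n)$ of highest weight $\lambda$, restricted to elements with eigenvalues $(\mathbf{x},\overline{\mathbf{x}})$; it equals $\mathrm{ch}^{SO(2n)}_{\lambda_+}+\mathrm{ch}^{SO(2n)}_{\lambda_-}$ with $\lambda_\pm=(\lambda_1,\dots,\lambda_{n-1},\pm\lambda_n)$. Here $\mathrm{ch}^{SO(2n)}_\mu$ is given by Weyl's formula $\sum_w\mathrm{sgn}(w)\mathbf{x}^{w(\mu+\rho)}/\sum_w\mathrm{sgn}(w)\mathbf{x}^{w(\rho)}$ with $w$ running over all permutations and even numbers of sign changes of the $n$ coordinates, $\mathrm{sgn}(w)$ the determinant of $w$, and $\rho=(n-1,n-2,\dots,0)$. *)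

(* Defs.v *)
From mathcomp Require Import all_boot all_order all_algebra all_fingroup.
From mathcomp Require Import fraction.
From mathcomp.multinomials Require Import mpoly.

Set Implicit Arguments.
Unset Strict Implicit.
Unset Printing Implicit Defensive.

Import GRing.Theory.
Local Open Scope ring_scope.

(* The indeterminates of {mpoly K[n]} are the formal square roots x_i^(1/2),
   so that all characters live in its field of fractions. *)
Notation ratfun K n := {fraction {mpoly K[n]}}.

Definition scal (K : idomainType) (n : nat) (c : K) : ratfun K n :=
  tofrac (c%:MP_[n]).

(* halfpow K i m is x_i^(m/2). *)
Definition halfpow (K : idomainType) (n : nat) (i : 'I_n) (m : int) :
    ratfun K n :=
  (tofrac ('X_i : {mpoly K[n]})) ^ m.

(* Weights are stored doubled: the column vector mu : 'cV[int]_n stands for the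
   weight mu / 2, whose components may be half-odd-integers. All the vectors
   below (rho2, weight31, ...) follow this convention. *)
Definition xpow (K : idomainType) (n : nat) (mu : 'cV[int]_n) : ratfun K n :=
  \prod_(i < n) halfpow K i (mu i 0).

(* The signed permutation that permutes the coordinates by s and then changes
   the sign of those indexed by E. *)
Definition signed_perm_mx (n : nat) (s : 'S_n) (E : {set 'I_n}) : 'M[int]_n :=
  diag_mx (\row_i (-1) ^+ (i \in E)) *m perm_mx s.

Definition weyl_sum (K : idomainType) (n : nat) (mu : 'cV[int]_n) :
    ratfun K n :=
  \sum_(s : 'S_n) \sum_(E : {set 'I_n} | ~~ odd #|E|)
    (\det (signed_perm_mx s E))%:~R * xpow K (signed_perm_mx s E *m mu).

(* 2 * (n - 1, n - 2, ..., 0), with i counted from 0 *)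
Definition rho2 (n : nat) : 'cV[int]_n := \col_(i < n) (2 * (n - i.+1))%N%:Z.

Definition chSO (K : idomainType) (n : nat) (mu : 'cV[int]_n) : ratfun K n :=
  weyl_sum K (mu + rho2 n) / weyl_sum K (rho2 n).

Definition flip_last (n : nat) (mu : 'cV[int]_n) : 'cV[int]_n :=
  \col_(i < n) (if i.+1 == n then - mu i 0 else mu i 0).

(* The irreducible spin representation of O(2n) of highest weight lambda, with
   lambda_n > 0, restricts to SO(2n) as the sum of the irreducibles of highest
   weights lambda_+ and lambda_-. *)
Definition chO (K : idomainType) (n : nat) (mu : 'cV[int]_n) : ratfun K n :=
  chSO K mu + chSO K (flip_last mu).

(* ((3/2)^q, (1/2)^(n-q)), doubled *)
Definition weight31 (n q : nat) : 'cV[int]_n :=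
  \col_(i < n) (if (i < q)%N then 3 else 1).

Fixpoint phi (K : pzRingType) (a1 a3 : K) (r : nat) : K :=
  match r with
  | 0 => 1
  | 1 => a1
  | 2 => a1 ^+ 2 - a1 * a3 - a3 ^+ 2
  | ((r3.+1 as r2).+1 as r1).+1 =>
      a1 * phi a1 a3 r1 - a1 * a3 * phi a1 a3 r2 + a3 ^+ 3 * phi a1 a3 r3
  end.

(* Main.v *)
Require Import Defs.
From mathcomp Require Import all_boot all_order all_algebra all_fingroup.
From mathcomp Require Import fraction.
From mathcomp.multinomials Require Import mpoly.
From mathcomp Require Import ring zify.
Import GRing.Theory.
Local Open Scope ring_scope.

(** With y_i = x_i^(1/2), the claim is a minor expansion of one determinant.

    The numerators of the SO(2n) characters for lambda_+ and lambda_- are sums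
    over even and over odd numbers of sign changes, so their sum is the full
    determinant det (y_i^(m_j) + y_i^(-m_j)), where m = 2 (lambda + rho)
    ([weyl_sum_flip]). The common denominator is a sum over even sign changes
    only; but the last coordinate of rho is 0, so the parity constraint can be
    traded for leaving that coordinate alone, and the denominator is the same
    determinant with its last column replaced by 1 ([weyl_sum_rho]). No
    division by 2 is involved, so characteristic 2 is covered. The denominator
    is nonzero because a column relation would give a polynomial of degree
    less than 2n with the 2n distinct roots x_i, 1 / x_i
    ([det_denom_mx_neq0]).

    For lambda = ((3/2)^q, (1/2)^(n-q)) the doubled exponents m are the odd
    numbers 2n+1, 2n-1, ..., 1 with the q-th one left out. All the numerators
    are thus the maximal minors of a single n x (n+1) matrix C
    ([chO_weight31]).

    Multiplying the i-th row of the denominator matrix by the i-th factor of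
    the product turns each column into a combination of at most four columns
    of C: the outcome is C B for a banded (n+1) x n matrix B with entries
    a_{1/2} and a_{3/2} ([spin_mx_band]). The recurrence of phi says exactly
    that the row vector v_j = (-1)^j a_{3/2}^j phi_{n-j} satisfies v B = 0
    ([phi_row_band]). Stacking v on top of C and putting the last unit vector
    e in front of B, the product is the block matrix

      [ v ]             [ v e   0  ]
      [ C ] [ e  B ]  = [ C e  C B ],

    and v e = det [e B] = (-1)^n a_{3/2}^n. Taking determinants, with the
    first factor expanded along v, and cancelling this common factor gives
    det (C B) as the sum of the a_{3/2}^q phi_{n-q} times the minors of C;
    the case a_{3/2} = 0 is treated apart ([det_mul_band]). *)

(** * Sums over sign changes *)

Definition toggle {n : nat} (l : 'I_n) (E : {set 'I_n}) : {set 'I_n} :=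
  [set i | (i == l) (+) (i \in E)].

Lemma toggleK (n : nat) (l : 'I_n) : involutive (toggle l).
Proof. by move=> E; apply/setP => i; rewrite !inE addKb. Qed.

Lemma odd_toggle (n : nat) (l : 'I_n) (E : {set 'I_n}) :
  odd #|toggle l E| = ~~ odd #|E|.
Proof.
have [lE | lE] := boolP (l \in E).
  have -> : toggle l E = E :\ l.
    by apply/setP => i; rewrite !inE; case: eqVneq => [->|]; rewrite ?lE.
  by rewrite [#|E|](cardsD1 l) lE oddD /= negbK.
have -> : toggle l E = l |: E.
  by apply/setP => i; rewrite !inE; case: eqVneq => [->|]; rewrite ?(negbTE lE).
by rewrite cardsU1 lE oddD.
Qed.

(** Toggling the sign of one coordinate [l] exchanges the even and the odd sign
    changes, so both halves of the expansion can be indexed by even sets. *)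
Lemma prod_sign_distr_even (R : comNzRingType) (n : nat) (l : 'I_n)
    (u : 'I_n -> bool -> R) :
  \prod_i (u i false + u i true)
  = \sum_(E : {set 'I_n} | ~~ odd #|E|) \prod_i u i (i \in E)
    + \sum_(E : {set 'I_n} | ~~ odd #|E|) \prod_i u i ((i == l) (+) (i \in E)).
Proof.
under eq_bigr do rewrite addrC.
rewrite bigA_distr (bigID (fun E : {set 'I_n} => odd #|E|)) /= addrC.
congr (_ + _).
  by apply: eq_bigr => E _; apply: eq_bigr => i _; case: ifP.
rewrite (reindex_inj (inv_inj (toggleK n l))) /=.
apply: eq_big => [E | E _]; first by rewrite odd_toggle.
by apply: eq_bigr => i _; rewrite inE; case: ifP.
Qed.

(** A sign that has no effect absorbs the parity condition: exactly one of the
    two choices at [l] makes the set even, so the other signs become free.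
    Halving the sum over all sets would fail in characteristic 2. *)
Lemma sum_even_fixed (R : comNzRingType) (n : nat) (l : 'I_n)
    (u : 'I_n -> bool -> R) :
  (forall b, u l b = 1) ->
  \sum_(E : {set 'I_n} | ~~ odd #|E|) \prod_i u i (i \in E)
  = \prod_i (if i == l then 1 else u i false + u i true).
Proof.
move=> ul.
(* [v] keeps only the sets avoiding [l], and its toggled version only those
   containing [l]. *)
pose v i b : R := if i == l then (~~ b)%:R else u i b.
have -> : \prod_i (if i == l then 1 else u i false + u i true)
    = \prod_i (v i false + v i true).
  by apply: eq_bigr => i _; rewrite /v; case: ifP; rewrite ?addr0.
rewrite (prod_sign_distr_even _ _ l) -big_split /=; apply: eq_bigr => E _.
pose rest := \prod_(i | i != l) u i (i \in E).
have split_l (w : 'I_n -> R) : (forall i, i != l -> w i = u i (i \in E)) ->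
    \prod_i w i = w l * rest.
  by move=> wE; rewrite (bigD1 l) //=; congr (_ * _); apply: eq_bigr.
rewrite (split_l (fun i => u i (i \in E))) // ul.
rewrite (split_l (fun i => v i (i \in E))) => [|i /negbTE il];
  last by rewrite /v il.
rewrite (split_l (fun i => v i _)) => [|i /negbTE il]; last by rewrite /v il.
rewrite /v eqxx; by case: (l \in E); rewrite /= ?mul1r ?mul0r ?addr0 ?add0r.
Qed.

(** * Weyl sums of type D as determinants *)

Definition sympow {F : fieldType} (z : F) (m : int) : F := z ^ m + z ^ (- m).

Lemma det_sum (R : comNzRingType) (n : nat) (f : 'I_n -> 'I_n -> R) :
  \det (\matrix_(i, j) f i j) = \sum_(s : 'S_n) (-1) ^+ s * \prod_i f i (s i).
Proof.
by apply: eq_bigr => s _; congr (_ * _); apply: eq_bigr => i _; rewrite mxE.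
Qed.

Lemma signed_perm_mx_mul (n : nat) (s : 'S_n) (E : {set 'I_n})
    (mu : 'cV[int]_n) (i : 'I_n) :
  (signed_perm_mx s E *m mu) i 0 = (-1) ^+ (i \in E) * mu (s i) 0.
Proof.
by rewrite /signed_perm_mx -mulmxA mul_diag_mx -row_permE !mxE.
Qed.

Lemma det_signed_perm_mx (n : nat) (s : 'S_n) (E : {set 'I_n}) :
  \det (signed_perm_mx s E) = (-1) ^+ #|E| * (-1) ^+ s.
Proof.
rewrite det_mulmx det_diag det_perm; congr (_ * _).
rewrite -sum1_card -prodrXr [RHS]big_mkcond /=.
by apply: eq_bigr => i _; rewrite mxE; case: ifP.
Qed.

Lemma weyl_sumE (K : idomainType) (n : nat) (mu : 'cV[int]_n) :
  weyl_sum K mu = \sum_(s : 'S_n) (-1) ^+ s *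
    \sum_(E : {set 'I_n} | ~~ odd #|E|)
      \prod_i halfpow K i ((-1) ^+ (i \in E) * mu (s i) 0).
Proof.
apply: eq_bigr => s _; rewrite mulr_sumr; apply: eq_bigr => E /negbTE oE.
rewrite det_signed_perm_mx -signr_odd oE mul1r rmorph_sign; congr (_ * _).
by apply: eq_bigr => i _; rewrite signed_perm_mx_mul.
Qed.

(** Negating the last coordinate of [mu] toggles the sign at the row that the
    permutation sends to the last column, so the two Weyl sums together run over
    all sign changes. *)
Lemma weyl_sum_flip (K : idomainType) (n : nat) (mu : 'cV[int]_n.+1) :
  weyl_sum K mu + weyl_sum K (flip_last mu)
  = \det (\matrix_(i, j) sympow (halfpow K i 1) (mu j 0)).
Proof.
rewrite det_sum !weyl_sumE -big_split /=; apply: eq_bigr => s _.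
rewrite -mulrDr; congr (_ * _).
pose l := (s^-1)%g ord_max.
pose u i b := halfpow K i ((-1) ^+ b * mu (s i) 0).
have -> : \prod_i sympow (halfpow K i 1) (mu (s i) 0)
    = \prod_i (u i false + u i true).
  by apply: eq_bigr => i _; rewrite /u /sympow /halfpow mul1r mulN1r.
rewrite (prod_sign_distr_even _ _ l u); congr (_ + _).
apply: eq_bigr => E _; apply: eq_bigr => i _; rewrite /u !mxE eqSS.
have -> : (s i == n :> nat) = (i == l).
  by rewrite -(inj_eq (@perm_inj _ s)) permKV -val_eqE.
by case: (i == l); case: (i \in E); rewrite /= ?mul1r ?mulN1r ?opprK.
Qed.

(** The entries y^(2k) + y^(-2k), for k = n-1, ..., 0, except that the column
    k = 0 is 1 instead of 2: this makes it usable in characteristic 2. *)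
Definition denom_mx {F : fieldType} (n : nat) (y : 'I_n -> F) : 'M[F]_n :=
  \matrix_(i, j) if j.+1 == n then 1 else sympow (y i) (2 * (n - j.+1))%N%:Z.

Lemma weyl_sum_rho (K : idomainType) (n : nat) :
  weyl_sum K (rho2 n.+1) = \det (denom_mx n.+1 (fun i => halfpow K i 1)).
Proof.
rewrite det_sum weyl_sumE; apply: eq_bigr => s _; congr (_ * _).
pose l := (s^-1)%g ord_max.
pose u i b := halfpow K i ((-1) ^+ b * rho2 n.+1 (s i) 0).
have El i : (s i == n :> nat) = (i == l).
  by rewrite -(inj_eq (@perm_inj _ s)) permKV -val_eqE.
rewrite (sum_even_fixed _ _ l u) => [|b].
  apply: eq_bigr => i _; rewrite eqSS El; case: ifP => // _.
  by rewrite /u /sympow /halfpow mul1r mulN1r mxE.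
by rewrite /u mxE permKV subnn mulr0.
Qed.

(** * A banded matrix and its minors *)

(** Column [j] holds the coefficients, in c_m = y^(2m+1) + y^(-2m-1), of

      (a1 (y + y^-1) + a3 (y^3 + y^-3)) (y^(2k) + y^(-2k)),  k = n-1-j,

    which is a3 c_{k+1} + a1 c_k + a1 c_{k-1} + a3 c_{k-2}, row [i] standing for
    c_{n-i}. Since c_{-1} = c_0, the row n+1 that c_{k-2} needs for k = 1 is
    folded back to n, whence the [minn]. For k = 0 the second factor is 1, and
    only the first two terms remain. *)
Definition band_mx {R : comNzRingType} (n : nat) (a1 a3 : R) :
    'M[R]_(n.+1, n) :=
  \matrix_(i, j) (a3 *+ (i == j :> nat) + a1 *+ (i == j.+1 :> nat)
    + (if (j.+1 < n)%N then
         a1 *+ (i == j.+2 :> nat) + a3 *+ (i == minn j.+3 n :> nat)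
       else 0)).

Lemma sum_pick (R : comNzRingType) (n k : nat) (g : nat -> R) (a : R) :
  (k <= n)%N -> \sum_(i < n.+1) g i * (a *+ (i == k :> nat)) = a * g k.
Proof.
move=> kn; rewrite (bigD1 (inord k)) //= inordK // eqxx mulr1n mulrC.
rewrite big1 ?addr0 // => i /negbTE ik.
by rewrite -[X in i == X :> nat](@inordK n) // val_eqE ik mulr0n mulr0.
Qed.

Lemma sum_band_mx (R : comNzRingType) (n : nat) (a1 a3 : R) (g : nat -> R)
    (j : 'I_n) :
  \sum_(i < n.+1) g i * band_mx n a1 a3 i j
  = a3 * g j + a1 * g j.+1
    + (if (j.+1 < n)%N then a1 * g j.+2 + a3 * g (minn j.+3 n) else 0).
Proof.
under eq_bigr do rewrite mxE !mulrDr.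
rewrite !big_split /= !sum_pick ?(ltnW (ltn_ord j)) //; congr (_ + _).
case: ifP => jn; last by rewrite big1 // => i _; rewrite mulr0.
under eq_bigr do rewrite mulrDr.
by rewrite big_split /= !sum_pick ?geq_minr.
Qed.

Lemma band_mx_lower (R : comNzRingType) (n : nat) (a1 a3 : R) (i : 'I_n.+1)
    (j : 'I_n) :
  (i < j)%N -> band_mx n a1 a3 i j = 0.
Proof.
move=> ij; have jn := ltn_ord j; rewrite mxE.
have /negbTE -> : i != j :> nat by lia.
have /negbTE -> : i != j.+1 :> nat by lia.
have /negbTE -> : i != j.+2 :> nat by lia.
have /negbTE -> : i != minn j.+3 n :> nat by lia.
by rewrite !mulr0n !add0r if_same.
Qed.

Lemma phi_rec (R : pzRingType) (a1 a3 : R) (r : nat) :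
  phi a1 a3 r.+3 = a1 * phi a1 a3 r.+2 - a1 * a3 * phi a1 a3 r.+1
                   + a3 ^+ 3 * phi a1 a3 r.
Proof. by []. Qed.

Lemma phi_a3_0 (R : comNzRingType) (a1 : R) (r : nat) : phi a1 0 r = a1 ^+ r.
Proof.
elim/ltn_ind: r => -[|[|[|r]]] IH //.
  by rewrite /= mulr0 expr0n !subr0.
rewrite phi_rec !IH ?leqnSn ?(leqW (leqnSn _)) //.
by rewrite mulr0 mul0r expr0n mul0r subr0 addr0 -exprS.
Qed.

Definition phi_row {R : comNzRingType} (n : nat) (a1 a3 : R) : 'rV[R]_n.+1 :=
  \row_j ((-1) ^+ j * a3 ^+ j * phi a1 a3 (n - j)).

(** Up to the factor (-1)^j a3^(j+1), column [j] of the product is the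
    recurrence for phi_{n-j}. In the last column but one, the term in
    phi_{-1} is replaced by the folded entry, which matches the irregular
    value of phi_2. *)
Lemma phi_row_band (R : comNzRingType) (n : nat) (a1 a3 : R) :
  phi_row n a1 a3 *m band_mx n a1 a3 = 0.
Proof.
apply/rowP => j; rewrite !mxE.
pose g k : R := (-1) ^+ k * a3 ^+ k * phi a1 a3 (n - k).
under eq_bigr => k _ do rewrite mxE -/(g k).
rewrite sum_band_mx /g; have jn := ltn_ord j.
case: ifP => [j1n | /negbT j1n]; last first.
  have -> : (n - j = 1)%N by lia.
  have -> : (n - j.+1 = 0)%N by lia.
  by rewrite /= !exprS; ring.
have [d nE] : exists d, n = (j + d.+2)%N by exists (n - j.+2)%N; lia.
have -> : (n - j = d.+2)%N by lia.
have -> : (n - j.+1 = d.+1)%N by lia.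
have -> : (n - j.+2 = d)%N by lia.
case: d nE => [|d] nE.
  have -> : minn j.+3 n = j.+2 by lia.
  have -> : (n - j.+2 = 0)%N by lia.
  by rewrite /= !exprS; ring.
have -> : minn j.+3 n = j.+3 by lia.
have -> : (n - j.+3 = d)%N by lia.
by rewrite phi_rec !exprS; ring.
Qed.

Lemma det_row'_band (R : comNzRingType) (n : nat) (a1 a3 : R) :
  \det (row' ord_max (band_mx n a1 a3)) = a3 ^+ n.
Proof.
have lE (i : 'I_n) : lift ord_max i = i :> nat by rewrite lift_max.
rewrite det_trig; last first.
  by apply/is_trig_mxP => i j ij; rewrite mxE band_mx_lower ?lE.
rewrite -[in RHS](card_ord n) -prodr_const; apply: eq_bigr => i _.
have iN := ltn_ord i; rewrite !mxE lE eqxx.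
have /negbTE -> : nat_of_ord i != i.+1 by lia.
have /negbTE -> : nat_of_ord i != i.+2 by lia.
have /negbTE -> : nat_of_ord i != minn i.+3 n by lia.
by rewrite mulr1n !mulr0n !addr0; case: ifP; rewrite addr0.
Qed.

(** This is the Cauchy-Binet formula for C times the band matrix, obtained
    without computing its minors: the left kernel vector [phi_row] yields
    the identity multiplied by [a3 ^+ n]. When [a3] vanishes, that carries no
    information; but then the first row of the band matrix is 0 and the rest
    is triangular, so only the term [q = 0] is left. *)
Lemma det_mul_band (F : idomainType) (n : nat) (a1 a3 : F)
    (C : 'M[F]_(n, n.+1)) :
  \det (C *m band_mx n a1 a3)
  = \sum_(q < n.+1) a3 ^+ q * phi a1 a3 (n - q) * \det (col' q C).
Proof.
have [-> | a3_neq0] := eqVneq a3 0.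
  rewrite big_ord_recl big1 => [|q _]; last by rewrite lift0 expr0n !mul0r.
  rewrite expr0 mul1r addr0 subn0 phi_a3_0.
  have -> : C *m band_mx n a1 0 = col' ord0 C *m row' ord0 (band_mx n a1 0).
    apply/matrixP => i j; rewrite !mxE big_ord_recl.
    rewrite [band_mx _ _ _ ord0 _]mxE !mul0rn !mulr0n /= add0r if_same.
    rewrite addr0 mulr0 add0r; apply: eq_bigr => k _.
    by rewrite [X in _ = X * _]mxE [X in _ = _ * X]mxE.
  rewrite det_mulmx mulrC; congr (_ * _).
  have rowE (i j : 'I_n) : row' ord0 (band_mx n a1 0) i j
      = a1 *+ (i == j :> nat)
        + (if (j.+1 < n)%N then a1 *+ (i == j.+1 :> nat) else 0).
    by rewrite !mxE lift0 !mul0rn add0r addr0 !eqSS.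
  rewrite det_trig; last first.
    apply/is_trig_mxP => i j ij; rewrite rowE.
    have /negbTE -> : i != j :> nat by lia.
    have /negbTE -> : i != j.+1 :> nat by lia.
    by rewrite !mulr0n add0r; case: ifP.
  rewrite -[in RHS](card_ord n) -prodr_const; apply: eq_bigr => i _.
  rewrite rowE eqxx; have /negbTE -> : nat_of_ord i != i.+1 by lia.
  by rewrite mulr0n mulr1n; case: ifP; rewrite addr0.
pose e : 'cV[F]_n.+1 := delta_mx ord_max 0.
pose M : 'M[F]_(1 + n) := col_mx (phi_row n a1 a3) C.
pose N : 'M[F]_(1 + n) := row_mx e (band_mx n a1 a3).
have ord0E : ord0 = lshift n 0 :> 'I_(1 + n) by exact: val_inj.
have detM : \det M
    = \sum_(q < n.+1) a3 ^+ q * phi a1 a3 (n - q) * \det (col' q C).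
  rewrite (expand_det_row _ ord0); apply: eq_bigr => q _.
  rewrite /cofactor add0n; have -> : row' ord0 (col' q M) = col' q C.
    by apply/matrixP => i j; rewrite 2!mxE -rshift1 col_mxEd [RHS]mxE.
  have -> : M ord0 q = phi_row n a1 a3 0 q by rewrite ord0E col_mxEu.
  by rewrite mxE mulrCA -!mulrA signrMK.
have detN : \det N = (-1) ^+ n * a3 ^+ n.
  rewrite (expand_det_col _ ord0) (bigD1 ord_max) //= big1 ?addr0 => [|i iN].
    rewrite /cofactor addn0 -(det_row'_band _ _ a1 a3).
    have -> : N ord_max ord0 = 1 by rewrite ord0E row_mxEl mxE !eqxx.
    rewrite mul1r; congr (_ * _); congr (\det _).
    apply/matrixP => i j; rewrite [RHS]mxE 2![LHS]mxE -rshift1.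
    exact: row_mxEr.
  have -> : N i ord0 = e i 0 by rewrite ord0E; exact: row_mxEl.
  by rewrite mxE (negbTE iN) mul0r.
have a3n : (-1) ^+ n * a3 ^+ n != 0 :> F.
  by rewrite mulf_neq0 ?expf_neq0 ?oppr_eq0 ?oner_eq0.
apply: (mulfI a3n); rewrite -detM -{2}detN mulrC -[RHS]mulrC -det_mulmx.
rewrite /M /N mul_col_row phi_row_band det_lblock mulrC; congr (_ * _).
rewrite det_mx11 mxE (bigD1 ord_max) //= big1 => [|i iN].
  by rewrite !mxE !eqxx subnn mulr1 mulr1 addr0.
by rewrite !mxE (negbTE iN) mulr0.
Qed.

(** * The Weyl denominator does not vanish *)

Lemma sympowV (F : fieldType) (z : F) (m : int) : sympow z^-1 m = sympow z m.
Proof. by rewrite /sympow !exprz_inv opprK addrC. Qed.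

(** A linear relation [v] between the columns says that the Laurent polynomial
    sum_j v_j (X^k + X^(-k)), k = n-1-j, where the term k = 0 is v_j alone,
    vanishes at all x_i = y_i^2 and, by symmetry, at all 1 / x_i. Multiplied by
    X^(n-1) it is a polynomial [Q] of
    degree less than 2n with 2n distinct roots, hence zero; the [v_j] are
    among its coefficients. *)
Lemma det_denom_mx_neq0 (F : fieldType) (n : nat) (y : 'I_n -> F) :
  (forall i, y i != 0) ->
  (forall i j, y i ^+ 2 = y j ^+ 2 -> i = j) ->
  (forall i j, y i ^+ 2 * y j ^+ 2 != 1) ->
  \det (denom_mx n y) != 0.
Proof.
move=> y0 y_inj y_neq; apply/negP; rewrite -det_tr => /det0P[v v0 vD].
pose Q : {poly F} := \sum_(j < n) v 0 j *:
  ('X^j + (if j.+1 == n then 0 else 'X^(2 * n - 2 - j))).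
have Qcoef k : Q`_k = \sum_(j < n) v 0 j * ((k == j)%:R
    + (if j.+1 == n then 0 else (k == 2 * n - 2 - j)%N%:R)).
  rewrite coef_sum; apply: eq_bigr => j _.
  by rewrite coefZ coefD coefXn; case: ifP; rewrite ?coef0 ?coefXn.
(* The upper half of the terms has degree at least n, so it does not interfere
   with the coefficients of degree less than n. *)
have Qlow (j : 'I_n) : Q`_j = v 0 j.
  rewrite Qcoef (bigD1 j) //= eqxx big1 => [|k kj].
    rewrite addr0; case: ifP => jn; first by rewrite addr0 mulr1.
    have /negbTE -> : j != (2 * n - 2 - j)%N :> nat by have := ltn_ord j; lia.
    by rewrite addr0 mulr1.
  rewrite eq_sym (inj_eq val_inj) (negbTE kj) add0r.
  case: ifP => kn; first by rewrite mulr0.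
  have /negbTE -> : j != (2 * n - 2 - k)%N :> nat.
    by have := ltn_ord j; have := ltn_ord k; lia.
  by rewrite mulr0.
have Q0 : Q != 0.
  apply: contraNneq v0 => Q0; apply/eqP/rowP => j.
  by rewrite -Qlow Q0 coef0 mxE.
have sizeQ : (size Q <= 2 * n)%N.
  apply/leq_sizeP => k kn; rewrite Qcoef big1 // => j _.
  have /negbTE -> : k != j by have := ltn_ord j; lia.
  have /negbTE -> : k != (2 * n - 2 - j)%N by have := ltn_ord j; lia.
  by rewrite if_same addr0 mulr0.
have Qroot z : z != 0 ->
    \sum_j v 0 j * (if j.+1 == n then 1 else sympow z (2 * (n - j.+1))%N%:Z) = 0 ->
    root Q (z ^+ 2).
  move=> z0 vz; apply/rootP.
  have -> : Q.[z ^+ 2] = z ^+ (2 * n.-1) * 0; last by rewrite mulr0.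
  rewrite -vz mulr_sumr horner_sum; apply: eq_bigr => j _.
  rewrite hornerZ mulrCA; congr (_ * _); rewrite hornerD hornerXn -exprM.
  have jn := ltn_ord j; case: ifP => [/eqP jn1 | jn1].
    by rewrite horner0 addr0 mulr1; congr (_ ^+ _); lia.
  rewrite hornerXn -exprM /sympow mulrDr -exprnP -exprnN addrC; congr (_ + _).
    by rewrite -exprD; congr (_ ^+ _); lia.
  have -> : (2 * n.-1 = 2 * j + 2 * (n - j.+1))%N by lia.
  by rewrite exprD mulfK // expf_neq0.
have vy i : \sum_j v 0 j *
    (if j.+1 == n then 1 else sympow (y i) (2 * (n - j.+1))%N%:Z) = 0.
  have := congr1 (fun w : 'rV_n => w 0 i) vD; rewrite !mxE; apply: etrans.
  by apply: eq_bigr => j _; rewrite !mxE.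
pose rs := [seq y i ^+ 2 | i <- enum 'I_n] ++ [seq (y i)^-1 ^+ 2 | i <- enum 'I_n].
have rs_root : all (root Q) rs.
  rewrite all_cat; apply/andP; split; apply/allP => _ /mapP[i _ ->]; apply: Qroot.
  - exact: y0.
  - exact: vy.
  - by rewrite invr_eq0.
  - by under eq_bigr do rewrite sympowV; apply: vy.
have rs_uniq : uniq rs.
  rewrite cat_uniq; apply/and3P; split.
  - by rewrite map_inj_uniq ?enum_uniq // => i j /y_inj.
  - apply/hasPn => _ /mapP[i _ ->]; apply/negP => /mapP[j _ /eqP].
    rewrite exprVn eq_sym => /eqP yij; have /eqP[] := y_neq j i.
    by rewrite yij mulVf // expf_neq0.
  - rewrite map_inj_uniq ?enum_uniq // => i j.
    by rewrite !exprVn => /invr_inj /y_inj.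
have := leq_trans (max_poly_roots Q0 rs_root rs_uniq) sizeQ.
have sz : size (enum 'I_n) = n by rewrite -cardE card_ord.
rewrite size_cat (size_map (fun i => y i ^+ 2)).
by rewrite (size_map (fun i => (y i)^-1 ^+ 2)) sz addnn -mul2n ltnn.
Qed.

Lemma halfpow1_neq0 (K : idomainType) (n : nat) (i : 'I_n) : halfpow K i 1 != 0.
Proof.
rewrite /halfpow expr1z tofrac_eq0; apply/eqP => /(congr1 (meval (fun=> 1))) /eqP.
by rewrite mevalXU meval0 oner_eq0.
Qed.

Lemma det_denom_halfpow_neq0 (K : idomainType) (n : nat) :
  \det (denom_mx n (fun i => halfpow K i 1)) != 0.
Proof.
apply: det_denom_mx_neq0 => [i | i j | i j]; first exact: halfpow1_neq0.
  rewrite /halfpow !expr1z.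
  rewrite -!rmorphXn => /eqP; rewrite tofrac_eq.
  (* Specialize the variable i to 1 and the others to 0. *)
  move=> /eqP/(congr1 (meval (fun k => (k == i)%:R))) /eqP.
  rewrite !rmorphXn /= !mevalXU eqxx expr1n.
  by have [-> // | _] := eqVneq j i; rewrite expr0n oner_eq0.
rewrite /halfpow !expr1z -!rmorphXn -rmorphM -(rmorph1 (@tofrac _)) tofrac_eq.
apply/eqP => /(congr1 (meval (fun=> 0))) /eqP.
by rewrite rmorphM !rmorphXn rmorph1 /= !mevalXU expr0n mul0r eq_sym oner_eq0.
Qed.

(** * Spin characters as minors *)

Definition spin_mx {F : fieldType} (n : nat) (y : 'I_n -> F) :
    'M[F]_(n, n.+1) :=
  \matrix_(i, j) sympow (y i) ((n - j).*2.+1)%:Z.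

Lemma flip_last_add_rho (n : nat) (mu : 'cV[int]_n) :
  flip_last mu + rho2 n = flip_last (mu + rho2 n).
Proof.
apply/colP => i; rewrite !mxE; case: eqP => // ->.
by rewrite subnn muln0 !addr0.
Qed.

(** The doubled exponents 2 (lambda + rho) are 2(n-1-j)+3 for j < q and
    2(n-1-j)+1 for j >= q: the odd numbers from 2n+1 down to 1, without
    the one in position q. *)
Lemma chO_weight31 (K : idomainType) (n : nat) (q : 'I_n.+2) :
  chO K (weight31 n.+1 q)
  = \det (col' q (spin_mx n.+1 (fun i => halfpow K i 1)))
    / \det (denom_mx n.+1 (fun i => halfpow K i 1)).
Proof.
rewrite /chO /chSO -mulrDl flip_last_add_rho weyl_sum_flip weyl_sum_rho.
congr (_ / _); congr (\det _); apply/matrixP => i j; rewrite !mxE.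
congr sympow; have jn := ltn_ord j; rewrite /= /bump; case: (leqP q j) => jq /=; lia.
Qed.

Lemma sympow_mul (F : fieldType) (z : F) (a b : int) :
  z != 0 -> sympow z a * sympow z b = sympow z (a + b) + sympow z (a - b).
Proof. by move=> z0; rewrite /sympow !opprD !opprK !expfzDr //; ring. Qed.

Lemma sympowN (F : fieldType) (z : F) (a : int) : sympow z (- a) = sympow z a.
Proof. by rewrite /sympow opprK addrC. Qed.

Lemma spin_mx_band (F : fieldType) (n : nat) (y : 'I_n -> F) (a1 a3 : F)
    (i j : 'I_n) :
  y i != 0 ->
  (spin_mx n y *m band_mx n a1 a3) i j
  = (a1 * sympow (y i) 1 + a3 * sympow (y i) 3) * denom_mx n y i j.
Proof.
move=> z0; rewrite !mxE.
pose g k := sympow (y i) ((n - k).*2.+1)%:Z.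
under eq_bigr => k _ do rewrite mxE -/(g k).
rewrite sum_band_mx /g; have jn := ltn_ord j.
have [jlast | jlast] := eqVneq j.+1 n.
  have -> : (n - j = 1)%N by lia.
  have -> : (n - j.+1 = 0)%N by lia.
  by rewrite jlast ltnn addr0 mulr1 addrC.
have jn1 : (j.+1 < n)%N by lia.
rewrite jn1 mulrDl -!mulrA !sympow_mul //.
have -> : sympow (y i) (1 - (2 * (n - j.+1))%N%:Z)
    = sympow (y i) ((n - j.+2).*2.+1)%:Z.
  by rewrite -sympowN; congr sympow; lia.
have -> : sympow (y i) (3 - (2 * (n - j.+1))%N%:Z)
    = sympow (y i) ((n - minn j.+3 n).*2.+1)%:Z.
  (* If n < j + 3, the exponent 3 - 2 (n - j - 1) is 1, already positive. *)
  have [n3 | n3] := leqP j.+3 n.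
    by rewrite -sympowN; congr sympow; lia.
  by congr sympow; lia.
have -> : 1 + (2 * (n - j.+1))%N%:Z = ((n - j.+1).*2.+1)%:Z by lia.
have -> : 3 + (2 * (n - j.+1))%N%:Z = ((n - j).*2.+1)%:Z by lia.
by ring.
Qed.

Lemma rmorph_phi (R S : pzRingType) (f : {rmorphism R -> S}) (a1 a3 : R)
    (r : nat) :
  f (phi a1 a3 r) = phi (f a1) (f a3) r.
Proof.
elim/ltn_ind: r => -[|[|[|r]]] IH.
- exact: rmorph1.
- by [].
- by rewrite /= !rmorphB !rmorphXn !rmorphM.
rewrite !phi_rec rmorphD rmorphB (rmorphM f (a3 ^+ 3)) rmorphXn !rmorphM !IH //.
by rewrite (leqW (leqnSn _)).
Qed.

Lemma scal_phi (K : idomainType) (n q r : nat) (a1 a3 : K) :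
  scal n (a3 ^+ q * phi a1 a3 r) = scal n a3 ^+ q * phi (scal n a1) (scal n a3) r.
Proof.
pose f : {rmorphism K -> ratfun K n} := @tofrac _ \o @mpolyC n K.
rewrite -[LHS]/(f _) -[scal n a3]/(f a3) -[scal n a1]/(f a1).
by rewrite -rmorph_phi rmorphM rmorphXn.
Qed.

(* a1 and a3 stand for a_{1/2} and a_{3/2}. *)
Theorem theorem7p2 (K : idomainType) (n : nat) (hn : (1 <= n)%N) (a1 a3 : K) :
  \prod_(i < n)
     (scal n a1 * (halfpow K i 1 + halfpow K i (-1))
      + scal n a3 * (halfpow K i 3 + halfpow K i (-3)))
  = \sum_(0 <= q < n.+1)
      scal n (a3 ^+ q * phi a1 a3 (n - q)) * chO K (weight31 n q).
Proof.
case: n hn => // n _; pose y i := halfpow K (i : 'I_n.+1) 1.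
have D0 := det_denom_halfpow_neq0 K n.+1.
apply: (mulIf D0); rewrite big_mkord mulr_suml.
under [RHS]eq_bigr => q _ do rewrite chO_weight31 scal_phi mulrA divfK //.
rewrite -det_mul_band.
pose d : 'rV_n.+1 :=
  \row_i (scal n.+1 a1 * sympow (y i) 1 + scal n.+1 a3 * sympow (y i) 3).
have -> : spin_mx n.+1 y *m band_mx n.+1 (scal n.+1 a1) (scal n.+1 a3)
    = diag_mx d *m denom_mx n.+1 y.
  apply/matrixP => i j; rewrite spin_mx_band; last exact: halfpow1_neq0.
  by rewrite mul_diag_mx [in RHS]mxE [d _ _]mxE.
rewrite det_mulmx det_diag; congr (_ * _); apply: eq_bigr => i _.
by rewrite mxE /sympow /y /halfpow !expr1z.
Qed.
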